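(* For $n\ge 1$ let $f(n)$ denote the number of pop-stacked permutations of $[n]=\{1,\dots,n\}$. There is an algorithm which, given a positive integer $N$, computes $f(n)$ for all $1\le n\le N$ in $O(N^4)$ time using $O(N^3)$ memory, where each arithmetic operation on integers is counted as $O(1)$ time and each stored integer is counted as $O(1)$ memory.
   Context: For a permutation $\pi=a_1a_2\cdots a_n$ of $[n]$, a descending run of $\pi$ is a maximal sequence of consecutive letters $a_i>a_{i+1}>\cdots>a_{i+j}$. Factor $\pi$ into its descending runs, $\pi=D_1D_2\cdots D_m$; the pop-stack operator $P$ reverses each run: $P(\pi)=D_1^rD_2^r\cdots D_m^r$, where $D^r$ is the reversal of the word $D$. A permutation $\sigma$ of $[n]$ is pop-stacked if $\sigma=P(\pi)$ for some permutation $\pi$ of $[n]$. *)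

(* Defs.v *)
From HB Require Import structures.
From mathcomp Require Import all_boot all_order all_algebra.

Set Implicit Arguments.
Unset Strict Implicit.
Unset Printing Implicit Defensive.

(** A permutation of [n] is a word over [nat], i.e. a member of
    [permutations (iota 1 n)] (a duplicate-free list). *)

(** Factorization into maximal descending runs: [x] joins the first run of the
    remaining word exactly when it is larger than the first letter of that run. *)
Fixpoint desc_runs (w : seq nat) : seq (seq nat) :=
  match w with
  | [::] => [::]
  | x :: w' =>
      match desc_runs w' with
      | (y :: D) :: Ds =>
          if y < x then (x :: y :: D) :: Ds else [:: x] :: (y :: D) :: Ds
      | _ => [:: [:: x]]
      end
  end.

Definition pop_stack (w : seq nat) : seq nat :=
  flatten [seq rev D | D <- desc_runs w].

Definition pop_stacked (n : nat) (s : seq nat) : bool :=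
  has (fun p => s == pop_stack p) (permutations (iota 1 n)).

Definition num_pop_stacked (n : nat) : nat :=
  count (pop_stacked n) (permutations (iota 1 n)).

(** Algorithms are structured programs for a unit-cost random access machine.
    The memory is an array of unbounded integers, with integer addresses (so
    that no address computation is ever partial).  Addresses may be computed,
    which gives indirect addressing. *)

Definition memory := int -> int.

Inductive expr : Type :=
  | Lit of int
  | Cell of expr
  | Add of expr & expr
  | Sub of expr & expr
  | Mul of expr & expr.

Inductive test : Type :=
  | TLt of expr & expr
  | TEq of expr & expr.

Inductive cmd : Type :=
  | Skip
  | Store of expr & expr  (* [Store a e] writes the value of [e] at address [a] *)
  | Seq of cmd & cmd
  | If of test & cmd & cmd
  | While of test & cmd.

Fixpoint eval (m : memory) (e : expr) : int :=
  match e with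
  | Lit z => z
  | Cell a => m (eval m a)
  | Add e1 e2 => (eval m e1 + eval m e2)%R
  | Sub e1 e2 => (eval m e1 - eval m e2)%R
  | Mul e1 e2 => (eval m e1 * eval m e2)%R
  end.

Definition eval_test (m : memory) (b : test) : bool :=
  match b with
  | TLt e1 e2 => (eval m e1 < eval m e2)%R
  | TEq e1 e2 => eval m e1 == eval m e2
  end.

(** Time: every constant, memory access, arithmetic operation and comparison
    costs one unit. *)
Fixpoint expr_time (e : expr) : nat :=
  match e with
  | Lit _ => 1
  | Cell a => (expr_time a).+1
  | Add e1 e2 | Sub e1 e2 | Mul e1 e2 => (expr_time e1 + expr_time e2).+1
  end.

Definition test_time (b : test) : nat :=
  match b with TLt e1 e2 | TEq e1 e2 => (expr_time e1 + expr_time e2).+1 end.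

(** Addresses read during an evaluation. *)
Fixpoint expr_cells (m : memory) (e : expr) : seq int :=
  match e with
  | Lit _ => [::]
  | Cell a => eval m a :: expr_cells m a
  | Add e1 e2 | Sub e1 e2 | Mul e1 e2 => expr_cells m e1 ++ expr_cells m e2
  end.

Definition test_cells (m : memory) (b : test) : seq int :=
  match b with TLt e1 e2 | TEq e1 e2 => expr_cells m e1 ++ expr_cells m e2 end.

Definition update (m : memory) (a v : int) : memory :=
  fun b => if b == a then v else m b.

(** [exec c m m' t A]: started in memory [m], the program [c] halts in memory
    [m'] after [t] units of time, and [A] lists (with repetitions) all addresses
    read or written along the way. *)
Inductive exec : cmd -> memory -> memory -> nat -> seq int -> Prop :=
  | ExecSkip m : exec Skip m m 1 [::]
  | ExecStore m a e :
      exec (Store a e) m (update m (eval m a) (eval m e))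
        (expr_time a + expr_time e).+1
        (eval m a :: expr_cells m a ++ expr_cells m e)
  | ExecSeq c1 c2 m m1 m2 t1 t2 A1 A2 :
      exec c1 m m1 t1 A1 -> exec c2 m1 m2 t2 A2 ->
      exec (Seq c1 c2) m m2 (t1 + t2) (A1 ++ A2)
  | ExecIfTrue b c1 c2 m m' t A :
      eval_test m b -> exec c1 m m' t A ->
      exec (If b c1 c2) m m' (test_time b + t) (test_cells m b ++ A)
  | ExecIfFalse b c1 c2 m m' t A :
      ~~ eval_test m b -> exec c2 m m' t A ->
      exec (If b c1 c2) m m' (test_time b + t) (test_cells m b ++ A)
  | ExecWhileTrue b c m m1 m2 t1 t2 A1 A2 :
      eval_test m b -> exec c m m1 t1 A1 -> exec (While b c) m1 m2 t2 A2 ->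
      exec (While b c) m m2 (test_time b + t1 + t2) (test_cells m b ++ A1 ++ A2)
  | ExecWhileFalse b c m :
      ~~ eval_test m b ->
      exec (While b c) m m (test_time b) (test_cells m b).

(** Memory usage: the number of distinct cells ever accessed. *)
Definition cells_used (A : seq int) : nat := size (undup A).

(** The input is placed at address 0; all other cells are initially 0. *)
Definition input (N : nat) : memory := fun a => if a == 0%R then Posz N else 0%R.

(* Main.v *)
Require Import Defs.
From mathcomp Require Import all_boot all_order all_algebra.
From mathcomp Require Import zify.
(* Reimported because [all_algebra] shadows the constructor [Add]. *)
Import Defs.

Set Implicit Arguments.
Unset Strict Implicit.
Unset Printing Implicit Defensive.

(** A permutation is pop-stacked iff any two adjacent ascending runs [R], [R']
    satisfy [min R < max R']: then reversing the runs gives a preimage whose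
    descending runs are exactly the reversed ones.

    Build a permutation by prepending letters given by their relative ranks.
    All that matters is the triple [(q, M, h)] of the ranks of the maximum of the
    second run, of the maximum of the first run, and of the first letter.  A letter
    below [h] extends the first run; a letter above [h] starts a new one, and is
    allowed only when [h < q].  There are O(N^3) triples, and with
      - C(q, M, h) = number of permutations of state (q, M, h') with h' >= h,
      - E(M, r) = sum over q of (C(q, M, 0) - C(q, M, min(q, r))), which counts those
        with maximum M and h < r, h < q,
    one has, for rank h and u = unbump h q,
      C'(q, M, h) = C'(q, M, h + 1)
                    + [q <> h] (C(u, M - 1, h) + [h = M] E(u, h)),
    so each length is obtained from the previous one in O(N^3) steps, in place. *)

(** * Adjacent ascending runs *)

(* In a state [(q, M, h)], [M] and [h] are the maximum and the minimum of the first
   ascending run and [q] is the maximum of the second one, or [inf] if there is none. *)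
Definition push (x : nat) (s : nat * nat * nat) : option (nat * nat * nat) :=
  let: (q, M, h) := s in
  if x < h then Some (q, M, x) else if h < q then Some (M, x, x) else None.

(** The word is read from right to left. The sentinel [inf], meant to exceed all letters, replaces
    the maximum of the missing run after the last one. [None] signals an empty word or two adjacent
    runs that fail to overlap. *)
Fixpoint scan (inf : nat) (w : seq nat) : option (nat * nat * nat) :=
  match w with
  | [::] => None
  | [:: x] => Some (inf, x, x)
  | x :: w' => obind (push x) (scan inf w')
  end.

(** [push] tests a run only when it closes; the run still open at the end is tested here. *)
Definition accepting (s : nat * nat * nat) : bool := s.2 < s.1.1.

Definition overlapping (inf : nat) (w : seq nat) : bool :=
  oapp accepting false (scan inf w).

Lemma scan_cons inf x w : w != [::] ->
  scan inf (x :: w) = obind (push x) (scan inf w).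
Proof. by case: w. Qed.

Lemma scan_neq_nil inf w s : scan inf w = Some s -> w != [::].
Proof. by case: w. Qed.

Lemma scan_head_le inf w q M h : scan inf w = Some (q, M, h) -> h <= M.
Proof.
elim: w q M h => [|x w IH] q M h //.
have [-> /= [_ -> ->] //|w0] := eqVneq w [::].
rewrite scan_cons //; case E: (scan inf w) => [[[q' M'] h']|] //=.
have /= := IH _ _ _ E; case: ifP => [xh hM [_ <- <-]|_ _]; first by lia.
by case: ifP => // _ [_ <- <-].
Qed.

(** * Factorizations into descending runs *)

Definition run_factorization (Ds : seq (seq nat)) : bool :=
  all (fun D => (D != [::]) && sorted gtn D) Ds
  && sorted (fun D D' => last 0 D < head 0 D') Ds.

Lemma run_factorization_cons D Ds :
  run_factorization (D :: Ds) =
  [&& D != [::], sorted gtn D,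
      (Ds == [::]) || (last 0 D < head 0 (head [::] Ds)) & run_factorization Ds].
Proof.
rewrite /run_factorization; case: Ds => [|D' Ds] /=; first by rewrite !andbT.
by do ?case: (_ == _) => //=; do ?case: (sorted _ _) => //=;
   case: (_ < _); rewrite /= ?andbF.
Qed.

Lemma desc_runs_neq_nil x w : exists y D Ds, desc_runs (x :: w) = (y :: D) :: Ds.
Proof.
rewrite /=; case: (desc_runs w) => [|[|y D] Ds]; first by exists x, [::], [::].
  by exists x, [::], [::].
by case: ifP => _; [exists x, (y :: D), Ds | exists x, [::], ((y :: D) :: Ds)].
Qed.

Lemma flatten_desc_runs w : flatten (desc_runs w) = w.
Proof.
elim: w => //= x w IH; case E: (desc_runs w) IH => [|[|y D] Ds] /= <- //.
  by case: w E => // z w; have [? [? [? ->]]] := desc_runs_neq_nil z w.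
by case: ifP.
Qed.

Lemma head_desc_runs x w : head 0 (head [::] (desc_runs (x :: w))) = x.
Proof. by rewrite /=; case: (desc_runs w) => [|[|y D] Ds] //; case: ifP. Qed.

(** Distinct letters turn the failed comparison at a cut into the strict ascent required between
    blocks. *)
Lemma desc_runs_factorization w : uniq w -> run_factorization (desc_runs w).
Proof.
elim: w => [|x [|z w] IH] //.
have [y [D [Ds E]]] := desc_runs_neq_nil z w.
have y_z : y = z by rewrite -(head_desc_runs z w) E.
rewrite -y_z in IH E *.
rewrite cons_uniq inE negb_or => /andP[/andP[x_y _]] /IH.
have -> : desc_runs [:: x, y & w] =
  if y < x then (x :: y :: D) :: Ds else [:: x] :: (y :: D) :: Ds.
  by rewrite [LHS]/= -/(desc_runs (y :: w)) E.
rewrite E; case: ltnP => xy H.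
  by move: H; rewrite !run_factorization_cons /= xy.
by rewrite run_factorization_cons H /=; lia.
Qed.

(** A descent inside a block forces a merge and an ascent between blocks forces a cut, so the
    factorization is unique. *)
Lemma desc_runs_flatten Ds : run_factorization Ds -> desc_runs (flatten Ds) = Ds.
Proof.
elim: Ds => [|D Ds IH] //; rewrite run_factorization_cons.
case/and4P => D0 sD lastD /IH {IH}.
elim: D D0 sD lastD => [|x [|y D] IH] //= _ sD lastD E.
  by rewrite E; case: Ds lastD {E IH} => [|[|y D'] Ds] //= /ltnW; rewrite ltnNge => ->.
case/andP: sD => yx sD; have {}IH := IH isT sD lastD E; rewrite /= in IH.
by rewrite IH yx.
Qed.

(** The letters of [D] are prepended from its head on, each below the current first letter, so every
    [push] extends the first run. *)
Lemma scan_ascending_prefix inf w q M h D : scan inf w = Some (q, M, h) ->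
  path gtn h D -> scan inf (rev D ++ w) = Some (q, M, last h D).
Proof.
elim: D w h => [|x D IH] w h E //= /andP[xh pD].
rewrite rev_cons cat_rcons; apply: IH => //.
by rewrite scan_cons ?(scan_neq_nil E) // E /= ifT.
Qed.

(** Reversed blocks may merge into longer ascending runs. Merging can only raise the maximum, hence
    the inequality [head 0 D <= M], which suffices for the overlap test. *)
Lemma scan_run_factorization inf D Ds :
  all (fun x => x < inf) (flatten (D :: Ds)) -> run_factorization (D :: Ds) ->
  exists q M, [/\ scan inf (flatten [seq rev D' | D' <- D :: Ds]) =
                    Some (q, M, last 0 D), head 0 D <= M & last 0 D < q].
Proof.
elim: Ds D => [|D1 Ds IH] [|x D] lt_inf; rewrite run_factorization_cons //.
  case/and4P => _ /= pD _ _.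
  exists inf, x; rewrite cats0 rev_cons -cats1; split=> //.
    exact: (@scan_ascending_prefix inf [:: x] inf x x).
  move: lt_inf; rewrite /= cats0 -[(x < inf) && _]/(all _ (x :: D)) => /allP.
  by apply; apply: mem_last.
case/and4P => _ /= pD lastD /IH [|q [M [E hM hq]]].
  by move: lt_inf; rewrite /= all_cat => /and3P[].
set w := (flatten _) in E; rewrite -[rev D1 ++ _]/w.
have w0 := scan_neq_nil E; have := scan_head_le E => le_M.
rewrite rev_cons cat_rcons.
(* The reversed first block ends with [x] and the next one begins with [last 0 D1]; their order
   decides whether the two merge. *)
have [xh|hx] := ltnP x (last 0 D1).
  exists q, M; split; last 2 first.
  - by lia.
  - apply: leq_ltn_trans hq; apply: leq_trans (ltnW xh).
    case: (lastP D) pD => // D' y; rewrite path_sortedE; last first.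
      by move=> a b c ab bc; apply: ltn_trans bc ab.
    case/andP=> /allP lt_x _; rewrite last_rcons; apply/ltnW/lt_x.
    by rewrite mem_rcons mem_head.
  - by apply: scan_ascending_prefix pD; rewrite scan_cons // E /= xh.
exists M, x; split=> //; last by apply: leq_trans lastD hM.
by apply: scan_ascending_prefix pD; rewrite scan_cons // E /= ltnNge hx hq.
Qed.

(** Each successful test in [push] is the inequality between two consecutive blocks. The test
    between [D] and [Ds] is still pending, so only [Ds] is claimed to be a factorization. *)
Lemma scan_decompose inf w q M h : scan inf w = Some (q, M, h) ->
  exists D Ds, [/\ w = rev D ++ flatten [seq rev D' | D' <- Ds],
    D != [::] /\ sorted gtn D, run_factorization Ds,
    head 0 D = M /\ last 0 D = h &
    (Ds == [::]) || (q == head 0 (head [::] Ds))].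
Proof.
elim: w q M h => [|x w IH] q M h //.
have [->|w0] := eqVneq w [::].
  by move=> [_ <- <-]; exists [:: x], [::].
rewrite scan_cons //; case E: (scan inf w) => [[[q' M'] h']|] //=.
have [D [Ds [def_w [D0 sD] rDs [hD lD] q'E]]] := IH _ _ _ E.
case: ifP => [xh [<- <- <-]|_].
  exists (rcons D x), Ds; split => //.
  - by rewrite rev_rcons /= -def_w.
  - split; first by case: (D).
    by case: D D0 sD lD {def_w hD} => // y D _ /= sD lD; rewrite rcons_path sD lD /= .
  - by rewrite last_rcons; split=> //; case: (D) D0 hD.
case: ifP => // h'q' [<- <- <-].
exists [:: x], (D :: Ds); split => //=; first by rewrite -def_w.
- rewrite run_factorization_cons D0 sD rDs lD andbT /=.
  by case/orP: q'E => [->|/eqP <-] //; rewrite h'q' orbT.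
- by rewrite hD.
Qed.

Lemma perm_flatten_rev (T : eqType) (Ds : seq (seq T)) :
  perm_eq (flatten [seq rev D | D <- Ds]) (flatten Ds).
Proof. by elim: Ds => //= D Ds IH; apply: perm_cat => //; rewrite perm_rev. Qed.

Lemma pop_stacked_overlapping n inf s : 0 < n -> n < inf ->
  s \in permutations (iota 1 n) -> pop_stacked n s = overlapping inf s.
Proof.
move=> n0 n_inf; rewrite mem_permutations => perm_s.
apply/hasP/idP => [[p]|].
  rewrite mem_permutations => perm_p /eqP ->.
  have /desc_runs_factorization : uniq p by rewrite (perm_uniq perm_p) iota_uniq.
  have p_inf : all (fun x => x < inf) p.
    by apply/allP => x; rewrite (perm_mem perm_p) mem_iota; lia.
  have p0 : p != [::].
    by move/perm_size: perm_p; rewrite size_iota; case: (p) => //=; lia.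
  rewrite /pop_stack /overlapping.
  case E: (desc_runs p) => [|D Ds] rDs; first by rewrite -(flatten_desc_runs p) E in p0.
  rewrite -(flatten_desc_runs p) E in p_inf.
  by have [q [M [-> _ /=]]] := scan_run_factorization p_inf rDs.
rewrite /overlapping; case E: (scan inf s) => [[[q M] h]|] //= hq.
have [D [Ds [def_s [D0 sD] rDs [hD lD] qE]]] := scan_decompose E.
(* Acceptance supplies the pending inequality between [D] and [Ds]. *)
have rDDs : run_factorization (D :: Ds).
  rewrite run_factorization_cons D0 sD rDs lD andbT /=.
  by case/orP: qE => [->|/eqP <-] //; rewrite -[_ < q]/(accepting (q, M, h)) hq orbT.
exists (flatten (D :: Ds)).
  rewrite mem_permutations; apply: perm_trans perm_s.
  by rewrite perm_sym def_s; exact: (perm_flatten_rev (D :: Ds)).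
by rewrite /pop_stack desc_runs_flatten // def_s.
Qed.

(** * Permutations by relative ranks *)

(* [push r] on relative ranks: the letters [>= r] already present move up by one. *)
Definition insert_rank (r : nat) (s : nat * nat * nat) :
    option (nat * nat * nat) :=
  let: (q, M, h) := s in
  if r <= h then Some (bump r q, M.+1, r)
  else if h < q then Some (bump r M, r, r) else None.

Lemma ltn_bump r a b : (bump r a < bump r b) = (a < b).
Proof. by rewrite /bump; do 2!case: leqP; lia. Qed.

(** [scan] only compares letters, and [bump r] is strictly increasing. *)
Lemma scan_map_bump r inf w : scan (bump r inf) (map (bump r) w) =
  omap (fun s => (bump r s.1.1, bump r s.1.2, bump r s.2)) (scan inf w).
Proof.
elim: w => [|x w IH] //; have [->//|w0] := eqVneq w [::].
rewrite map_cons !scan_cons ?IH //; last by case: (w) w0.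
case: (scan inf w) => [[[q M] h]|] //=; rewrite !ltn_bump.
by do 2![case: ifP => _ //].
Qed.

Lemma scan_insert r n w : r <= n -> w != [::] ->
  scan n.+1 (r :: map (bump r) w) = obind (insert_rank r) (scan n w).
Proof.
(* Since [r <= n], the sentinel [n] is shifted like a letter. *)
move=> r_n w0; have def_n : n.+1 = bump r n by rewrite /bump r_n.
rewrite scan_cons; last by case: (w) w0.
rewrite def_n scan_map_bump; case E: (scan n w) => [[[q M] h]|] //=.
have h_M := scan_head_le E; rewrite ltn_bump.
have -> : (r < bump r h) = (r <= h) by rewrite /bump; case: leqP; lia.
case: ifP => // r_h; rewrite /bump; congr (Some (_, _, _)).
by rewrite (leq_trans r_h h_M).
Qed.

(** A permutation is determined by its first letter and the relative order of the others, so each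
    one arises exactly once. *)
Fixpoint perms_by_rank (n : nat) : seq (seq nat) :=
  match n with
  | 0 => [:: [::]]
  | n'.+1 => [seq r :: map (bump r) w | w <- perms_by_rank n', r <- iota 0 n]
  end.

Lemma bump_inj r : injective (bump r).
Proof. exact: can_inj (bumpK r). Qed.

Lemma perms_by_rank_sub n w : w \in perms_by_rank n -> perm_eq w (iota 0 n).
Proof.
elim: n w => [|n IH] w; first by rewrite inE => /eqP ->.
case/allpairsP => -[w' r] [/IH pw' r_n ->].
have {}r_n : r <= n by move: r_n; rewrite mem_iota.
rewrite [(w', r).1]/= [(w', r).2]/= in pw' *.
have u : uniq (r :: map (bump r) w').
  rewrite /= (map_inj_uniq (@bump_inj r)) (perm_uniq pw') iota_uniq andbT.
  by apply/mapP => -[x _ /eqP]; rewrite (negPf (neq_bump _ _)).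
apply: uniq_perm (iota_uniq _ _) _ => //.
apply: (fun h1 h2 => (uniq_min_size u h1 h2).2) => [x|]; last first.
  by rewrite size_iota /= size_map (perm_size pw') size_iota.
rewrite inE mem_iota => /orP[/eqP->|/mapP[y]]; first by lia.
by rewrite (perm_mem pw') mem_iota /bump => y_n ->; case: leqP; lia.
Qed.

Lemma size_perms_by_rank n : size (perms_by_rank n) = n`!.
Proof.
elim: n => [|n IH] //.
by rewrite [LHS]size_allpairs IH size_iota factS mulnC.
Qed.

Lemma uniq_perms_by_rank n : uniq (perms_by_rank n).
Proof.
elim: n => [|n IH] //; apply: allpairs_uniq (iota_uniq _ _) _ => //.
by move=> [w r] [w' r'] _ _ /= [-> /(inj_map (@bump_inj r'))->].
Qed.

(** Both lists are duplicate-free of length [n!], so one inclusion suffices. *)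
Lemma perm_permutations_iota n :
  perm_eq (permutations (iota 1 n)) (map (map succn) (perms_by_rank n)).
Proof.
have u : uniq (map (map succn) (perms_by_rank n)).
  by rewrite (map_inj_uniq (inj_map succn_inj)) uniq_perms_by_rank.
rewrite perm_sym; apply: uniq_perm (permutations_uniq _) _ => //.
apply: (fun h1 h2 => (uniq_min_size u h1 h2).2) => [_ /mapP[w w_n ->]|].
  rewrite mem_permutations -[iota 1 n]/(iota (1 + 0) n) iotaDl.
  exact: perm_map (perms_by_rank_sub w_n).
rewrite size_map size_perms_by_rank size_permutations ?iota_uniq //.
by rewrite size_iota.
Qed.

(* Index [k] stands for permutations of [k + 1] letters; multiplicities are kept. *)
Fixpoint states (k : nat) : seq (nat * nat * nat) :=
  match k with
  | 0 => [:: (1, 0, 0)]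
  | k'.+1 => flatten [seq pmap (insert_rank^~ s) (iota 0 k.+1) | s <- states k']
  end.

Lemma pmap_flatten (T U : Type) (f : T -> option U) (ss : seq (seq T)) :
  pmap f (flatten ss) = flatten [seq pmap f s | s <- ss].
Proof. by elim: ss => //= s ss <-; rewrite pmap_cat. Qed.

Lemma eq_in_pmap (T : eqType) (U : Type) (f g : T -> option U) (s : seq T) :
  {in s, f =1 g} -> pmap f s = pmap g s.
Proof.
elim: s => //= x s IH fg; rewrite fg ?mem_head // IH // => y y_s.
by apply: fg; rewrite inE y_s orbT.
Qed.

Lemma pmap_map (S T U : Type) (f : T -> option U) (g : S -> T) (s : seq S) :
  pmap f (map g s) = pmap (f \o g) s.
Proof. by elim: s => //= x s ->. Qed.

Lemma flatten_pmap_obind (S T U : Type) (f : S -> option T)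
    (g : U -> T -> option T) (us : seq U) (s : seq S) :
  flatten [seq pmap (g^~ y) us | y <- pmap f s] =
  flatten [seq pmap (fun u => obind (g u) (f x)) us | x <- s].
Proof.
elim: s => //= x s IH; case: (f x) => [y|] /=; rewrite -IH //.
by have -> : pmap (fun=> None) us = [::] :> seq T by elim: (us).
Qed.

(** Induction by [scan_insert]: a failed scan stays failed when a letter is prepended, so [pmap] may
    drop it at once. *)
Lemma pmap_scan_perms k : pmap (scan k.+1) (perms_by_rank k.+1) = states k.
Proof.
elim: k => [|k IH] //.
rewrite -[perms_by_rank k.+2]/
  [seq r :: map (bump r) w | w <- perms_by_rank k.+1, r <- iota 0 k.+2].
rewrite pmap_flatten -map_comp.
rewrite -[states k.+1]/
  (flatten [seq pmap (insert_rank^~ s) (iota 0 k.+2) | s <- states k]) -IH.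
rewrite (flatten_pmap_obind _ insert_rank); congr flatten.
apply/eq_in_map => w w_k; rewrite /comp pmap_map; apply: eq_in_pmap => r.
rewrite mem_iota => r_k; apply: scan_insert; first by lia.
by move/perms_by_rank_sub/perm_size: w_k; case: w.
Qed.

Lemma num_pop_stacked_states k :
  num_pop_stacked k.+1 = count accepting (states k).
Proof.
rewrite /num_pop_stacked.
rewrite (@eq_in_count _ _ (overlapping k.+2)); last first.
  by move=> s s_n; apply: pop_stacked_overlapping.
rewrite (permP (perm_permutations_iota _)) count_map -pmap_scan_perms.
elim: (perms_by_rank k.+1) => //= w ws ->.
(* Adding one to every letter is [bump 0], which also sends the sentinel [k.+1] to [k.+2]. *)
rewrite /overlapping -[map succn w]/(map (bump 0) w) -[k.+2]/(bump 0 k.+1).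
rewrite scan_map_bump; case: (scan k.+1 w) => [[[q M] h]|] //=.
Qed.

(** * Recurrences *)

(* This is C(q, M, h) for [b = M + 1]: the shift makes the row [b = 0] vanish. *)
Definition suffix_count (k q b h : nat) : nat :=
  count (fun s => [&& s.1.1 == q, s.1.2.+1 == b & h <= s.2]) (states k).

(* At [q = 0] this is E(M, r). *)
Definition accept_count (k M r q : nat) : nat :=
  count (fun s => [&& s.1.2 == M, q <= s.1.1, s.2 < r & accepting s]) (states k).

Definition accept_from (k M : nat) : nat :=
  count (fun s => (M <= s.1.2) && accepting s) (states k).

(** Reduces the recurrences below to identities between indicators at a single state. *)
Lemma count_addn (T : eqType) (a b c d : pred T) (s : seq T) :
  {in s, forall x, a x + b x = c x + d x} ->
  count a s + count b s = count c s + count d s.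
Proof.
elim: s => //= x s IH abcd; rewrite addnACA (abcd x) ?mem_head // IH.
  by rewrite addnACA.
by move=> y y_s; apply: abcd; rewrite inE y_s orbT.
Qed.

(** Ranks are at most [k]; only [q] can reach [k.+1], the sentinel. *)
Lemma states_bound k s : s \in states k ->
  [&& s.1.1 <= k.+1, s.1.2 <= k & s.2 <= k].
Proof.
elim: k s => [|k IH] s; first by rewrite inE => /eqP ->.
case/flatten_mapP => -[[q M] h] /IH {}IH.
rewrite mem_pmap => /mapP[r].
rewrite mem_iota => r_k; rewrite /insert_rank.
have le_bump x m : x <= m -> bump r x <= m.+1 by rewrite /bump; case: leqP; lia.
move: IH => /= /and3P[q_k M_k h_k]; have := le_bump _ _ q_k; have := le_bump _ _ M_k.
by case: ifP => [rh|_]; [|case: ifP => // _] => ? ? [->] /=; lia.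
Qed.

Lemma suffix_count_ge k q b h : k < h -> suffix_count k q b h = 0.
Proof.
move=> k_h; apply/eqP; rewrite -leqn0 leqNgt -has_count.
by apply/hasPn => s /states_bound /=; rewrite /accepting; lia.
Qed.

Lemma suffix_count_row0 k q h : suffix_count k q 0 h = 0.
Proof.
apply/eqP; rewrite -leqn0 leqNgt -has_count.
by apply/hasPn => s _; rewrite andbF.
Qed.

Lemma accept_count_ge k M r q : k.+1 < q -> accept_count k M r q = 0.
Proof.
move=> k_q; apply/eqP; rewrite -leqn0 leqNgt -has_count.
by apply/hasPn => s /states_bound /=; rewrite /accepting; lia.
Qed.

Lemma accept_from_ge k M : k < M -> accept_from k M = 0.
Proof.
move=> k_q; apply/eqP; rewrite -leqn0 leqNgt -has_count.
by apply/hasPn => s /states_bound /=; rewrite /accepting; lia.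
Qed.

Lemma accept_from0 k : accept_from k 0 = num_pop_stacked k.+1.
Proof. by rewrite num_pop_stacked_states. Qed.

(** Every state has [h <= k], so the bound [r = k.+1] excludes nothing. *)
Lemma accept_from_rec k M :
  accept_from k M = accept_from k M.+1 + accept_count k M k.+1 0.
Proof.
rewrite -[LHS]addn0 -[X in _ + X = _](count_pred0 (states k)).
apply: count_addn => -[[q' M'] h'] /states_bound /=; rewrite /accepting /=.
lia.
Qed.

(** For states with second maximum [q], being accepted with [h < r] amounts to [h < minn q r]. The
    additive form avoids truncated subtraction. *)
Lemma accept_count_rec k M r q :
  accept_count k M r q + suffix_count k q M.+1 (minn q r) =
  accept_count k M r q.+1 + suffix_count k q M.+1 0.
Proof.
apply: count_addn => -[[q' M'] h'] _; rewrite /accepting /=; lia.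
Qed.

(** An insertion puts its rank in the third component, so only rank [h] can produce [(q, M, h)]. *)
Lemma count_insert_rank k s q M h :
  count (pred1 (q, M, h)) (pmap (insert_rank^~ s) (iota 0 k)) =
  (h < k) && (insert_rank h s == Some (q, M, h)).
Proof.
have -> : count (pred1 (q, M, h)) (pmap (insert_rank^~ s) (iota 0 k)) =
    count (fun r => (r == h) && (insert_rank h s == Some (q, M, h))) (iota 0 k).
  elim: (iota 0 k) => //= r rs IH; have [-> {r}|r_h] /= := eqVneq r h.
    by case: (insert_rank h s) IH => [s'|] /= ->.
  have : insert_rank r s != Some (q, M, h).
    case: s {IH} => -[a b] c /=; apply: contra r_h.
    by case: ifP => [_ /eqP[_ _ ->]|_] //; case: ifP => // _ /eqP[_ _ ->].
  case: (insert_rank r s) => [s'|] /=; rewrite -IH //.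
  by rewrite -[s' == _]/(Some s' == Some _) => /negPf ->.
case: (insert_rank h s == _); rewrite ?andbT ?andbF.
  rewrite (eq_count (a2 := pred1 h)); last by move=> r; rewrite /= andbT.
  by rewrite count_uniq_mem ?iota_uniq // mem_iota.
by rewrite (eq_count (a2 := pred0)) ?count_pred0 // => r; rewrite andbF.
Qed.

Lemma eq_bump h x q : (bump h x == q) = (q != h) && (x == unbump h q).
Proof.
have [->|q_h] /= := eqVneq q h; first by rewrite eq_sym (negPf (neq_bump _ _)).
by apply/eqP/eqP => [<-|->]; rewrite ?bumpK // unbumpK.
Qed.

(** New states with first letter exactly [h] arise in two ways. If the old first letter is at least
    [h], the run is extended and its maximum moves from [b - 1] to [b]. If it is smaller, an
    accepted run of maximum [unbump h q] becomes the second run and [h] alone forms the first, so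
    [b = h]. The case [q = h] is impossible because [bump h] misses [h]. *)
Lemma suffix_count_rec k q b h : h <= k.+1 ->
  suffix_count k.+1 q b.+1 h = suffix_count k.+1 q b.+1 h.+1 +
    if q == h then 0 else
      suffix_count k (unbump h q) b h +
      if h == b then accept_count k (unbump h q) h 0 else 0.
Proof.
move=> h_k.
have -> : suffix_count k.+1 q b.+1 h = suffix_count k.+1 q b.+1 h.+1 +
    count (pred1 (q, b, h)) (states k.+1).
  rewrite -[LHS]addn0 -[X in _ + X = _](count_pred0 (states k.+1)).
  apply: count_addn => -[[q' M'] h'] _; rewrite /= eqSS !xpair_eqE.
  by do 2!case: eqP => //= _; rewrite addn0; case: ltngtP.
congr addn.
rewrite -[states k.+1]/
  (flatten [seq pmap (insert_rank^~ s) (iota 0 k.+2) | s <- states k]).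
rewrite count_flatten -map_comp (eq_map (g := fun s => 
  (insert_rank h s == Some (q, b, h)) : nat)); last first.
  by move=> s; rewrite /comp count_insert_rank ltnS h_k.
rewrite /suffix_count /accept_count.
have sumE (T : Type) (a : pred T) (s : seq T) :
    sumn [seq (a x : nat) | x <- s] = count a s.
  by rewrite sumn_count.
rewrite sumE.
have -> : (if q == h then 0 else
    count (fun s => [&& s.1.1 == unbump h q, s.1.2.+1 == b & h <= s.2]) (states k) +
    if h == b then count (fun s => [&& s.1.2 == unbump h q, 0 <= s.1.1, s.2 < h
      & accepting s]) (states k) else 0) =
  count (fun s => (q != h) && [&& s.1.1 == unbump h q, s.1.2.+1 == b & h <= s.2])
    (states k) +
  count (fun s => [&& q != h, h == b, s.1.2 == unbump h q, s.2 < h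
      & accepting s]) (states k).
  case: (q == h) => /=; first by rewrite count_pred0.
  by case: (h == b) => //=; rewrite count_pred0.
rewrite -[LHS]addn0 -[X in _ + X = _](count_pred0 (states k)).
apply: count_addn => -[[q' M'] h'] _ /=; rewrite addn0 /accepting /=.
case: (leqP h h') => hh' /=.
  rewrite !andbF addn0 andbT -[Some _ == _]/((_, _, _) == _) !xpair_eqE eqxx andbT eq_bump.
  by rewrite andbA.
rewrite !andbF /=; case: ifP => hq; last by rewrite ?hq !andbF.
rewrite -[Some _ == _]/((_, _, _) == _) !xpair_eqE eqxx ?hq !andbT eq_bump -andbA.
by congr (nat_of_bool (_ && _)); rewrite andbC.
Qed.

(** * A Hoare logic with time bounds *)

(** Three separate stores confine the aliasing arguments to the lemmas on [represents]. *)
Record heap := Heap {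
  var : nat -> int;
  tab : nat -> nat -> nat -> int;
  out : nat -> int }.

Definition set_var (s : heap) i v :=
  Heap (fun j => if j == i then v else var s j) (tab s) (out s).

Definition set_tab (s : heap) a b c v :=
  Heap (var s)
    (fun a' b' c' => if [&& a' == a, b' == b & c' == c] then v else tab s a' b' c')
    (out s).

Definition set_out (s : heap) n v :=
  Heap (var s) (tab s) (fun j => if j == n then v else out s j).

Definition empty_heap := Heap (fun=> 0%R) (fun _ _ _ => 0%R) (fun=> 0%R).

(** The largest table index is [q + 2] with [q <= N + 1], hence the base [N + 4]. *)
Definition radix (N : nat) := N + 4.

Definition tab_addr (N a b c : nat) : nat := (a * radix N + b) * radix N + c.

(** The regions are disjoint: variables have negative addresses, outputs occupy [1..N], and a
    leading digit [a > 0] puts the table beyond [N]. *)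
Definition represents (N : nat) (m : memory) (s : heap) : Prop :=
  [/\ m 0%R = N,
      forall i, i < 8 -> m (Negz i) = var s i,
      forall a b c, 0 < a < radix N -> b < radix N -> c < radix N ->
        m (tab_addr N a b c) = tab s a b c
    & forall n, 0 < n <= N -> m n = out s n].

Lemma represents_input N : represents N (input N) empty_heap.
Proof.
split=> // [a b c a_N b_N c_N|n n_N].
  rewrite /input /tab_addr; case: eqP => // -[]; rewrite /radix in a_N b_N c_N *; nia.
by rewrite /input; case: eqP => // -[]; lia.
Qed.

Lemma mixed_radix_inj d a b a' b' : b < d -> b' < d ->
  a * d + b = a' * d + b' -> a = a' /\ b = b'.
Proof.
move=> b_d b'_d E; have d0 : 0 < d by exact: leq_ltn_trans b_d.
split; last by rewrite -(modn_small b_d) -(modn_small b'_d) -(modnMDl a) E modnMDl.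
by rewrite -[a](addn0) -(divn_small b_d) -divnMDl // E divnMDl // divn_small ?addn0.
Qed.

Lemma tab_addr_gt N a b c : 0 < a -> N < tab_addr N a b c.
Proof. by rewrite /tab_addr /radix; nia. Qed.

Lemma represents_set_var N m s i v : represents N m s -> i < 8 ->
  represents N (update m (Negz i) v) (set_var s i v).
Proof.
by case=> m0 mv mt mo i8; split=> // j j8; rewrite /update /= -mv.
Qed.

Lemma represents_set_tab N m s a b c v : represents N m s ->
  0 < a < radix N -> b < radix N -> c < radix N ->
  represents N (update m (tab_addr N a b c) v) (set_tab s a b c v).
Proof.
case=> m0 mv mt mo a_N b_N c_N; have lt_N := @tab_addr_gt N a b c.
split=> [|j j8|a' b' c' a'_N b'_N c'_N|n n_N]; rewrite /update.
- by case: eqP => // -[]; lia.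
- by rewrite /= -mv.
- rewrite /= -mt //; case: eqP => [[E]|E].
    have [/mixed_radix_inj[]// -> -> ->] := mixed_radix_inj c'_N c_N E.
    by rewrite !eqxx.
  by case: and3P => // -[/eqP E1 /eqP E2 /eqP E3]; case: E; rewrite E1 E2 E3.
- by rewrite -mo //; case: eqP => // -[]; lia.
Qed.

Lemma represents_set_out N m s n v : represents N m s -> 0 < n <= N ->
  represents N (update m n v) (set_out s n v).
Proof.
case=> m0 mv mt mo n_N.
split=> [|j j8|a b c a_N b_N c_N|j j_N]; rewrite /update.
- by case: eqP => // -[]; lia.
- by rewrite /= -mv.
- rewrite /= -mt //; case: eqP => // -[E].
  by have := @tab_addr_gt N a b c; lia.
- by rewrite /= -mo.
Qed.

(** Confining every access to an interval of cubic length bounds the distinct cells without tracking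
    which ones are used. *)
Definition in_range (N : nat) (a : int) : bool := `|a|%N <= radix N ^ 3.

Lemma in_range_var N i : i < 8 -> in_range N (Negz i).
Proof. by rewrite /in_range /radix; nia. Qed.

Lemma in_range_tab N a b c : a < radix N -> b < radix N -> c < radix N ->
  in_range N (tab_addr N a b c).
Proof. by rewrite /in_range /tab_addr absz_nat; nia. Qed.

Lemma in_range_out N n : n <= N -> in_range N n.
Proof. by rewrite /in_range /radix absz_nat; nia. Qed.

Lemma cells_used_in_range N A : all (in_range N) A ->
  cells_used A <= (radix N ^ 3).*2.+1.
Proof.
move=> /allP A_N; set B := _ ^ 3.
have -> : B.*2.+1 = size (map Posz (iota 0 B.+1) ++ map Negz (iota 0 B)).
  by rewrite size_cat !size_map !size_iota; lia.
apply: uniq_leq_size (undup_uniq _) _ => a; rewrite mem_undup => /A_N.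
rewrite /in_range -/B mem_cat; case: a => a a_B; apply/orP; [left|right].
  by apply: map_f; rewrite mem_iota; lia.
by apply: map_f; rewrite mem_iota; lia.
Qed.

(** * Evaluation of expressions *)

Definition evaluates N (s : heap) (e : expr) (z : int) : Prop :=
  forall m, represents N m s -> eval m e = z /\ all (in_range N) (expr_cells m e).

Definition VarE (i : nat) : expr := Cell (Lit (Negz i)).
Definition ShiftE (i c : nat) : expr := Add (VarE i) (Lit c).
Definition RadixE : expr := Add (Cell (Lit 0%R)) (Lit 4).
Definition TabAddrE (ea eb ec : expr) : expr :=
  Add (Mul (Add (Mul ea RadixE) eb) RadixE) ec.
Definition TabE (ea eb ec : expr) : expr := Cell (TabAddrE ea eb ec).

Section Evaluation.
Context (N : nat) (s : heap).

Lemma evaluates_lit z : evaluates N s (Lit z) z.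
Proof. by []. Qed.

Lemma evaluates_add e1 e2 z1 z2 : evaluates N s e1 z1 -> evaluates N s e2 z2 ->
  evaluates N s (Add e1 e2) (z1 + z2)%R.
Proof.
by move=> ev1 ev2 m rep; have [<- c1] := ev1 m rep; have [<- c2] := ev2 m rep;
  split=> //=; rewrite all_cat c1.
Qed.

Lemma evaluates_sub e1 e2 z1 z2 : evaluates N s e1 z1 -> evaluates N s e2 z2 ->
  evaluates N s (Sub e1 e2) (z1 - z2)%R.
Proof.
by move=> ev1 ev2 m rep; have [<- c1] := ev1 m rep; have [<- c2] := ev2 m rep;
  split=> //=; rewrite all_cat c1.
Qed.

Lemma evaluates_mul e1 e2 z1 z2 : evaluates N s e1 z1 -> evaluates N s e2 z2 ->
  evaluates N s (Mul e1 e2) (z1 * z2)%R.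
Proof.
by move=> ev1 ev2 m rep; have [<- c1] := ev1 m rep; have [<- c2] := ev2 m rep;
  split=> //=; rewrite all_cat c1.
Qed.

Lemma evaluates_cell e a z : evaluates N s e a -> in_range N a ->
  (forall m, represents N m s -> m a = z) -> evaluates N s (Cell e) z.
Proof.
by move=> ev a_N H m rep; have [E cells] := ev m rep; rewrite /= E cells a_N H.
Qed.

Lemma evaluates_var i : i < 8 -> evaluates N s (VarE i) (var s i).
Proof.
move=> i8; apply: evaluates_cell (evaluates_lit _) (in_range_var _ i8) _.
by move=> m [_ mv _ _]; exact: mv.
Qed.

Lemma evaluates_shift i c x : i < 8 -> var s i = Posz x ->
  evaluates N s (ShiftE i c) (x + c)%N.
Proof.
move=> i8 xE; rewrite PoszD -xE.
exact: evaluates_add (evaluates_var i8) (evaluates_lit _).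
Qed.

Lemma evaluates_input : evaluates N s (Cell (Lit 0%R)) N.
Proof.
apply: evaluates_cell (evaluates_lit _) _ _; first exact: (@in_range_out N 0).
by move=> m [].
Qed.

Lemma evaluates_tab_addr ea eb ec (a b c : nat) : evaluates N s ea a ->
  evaluates N s eb b -> evaluates N s ec c ->
  evaluates N s (TabAddrE ea eb ec) (tab_addr N a b c).
Proof.
have evR : evaluates N s RadixE (radix N).
  by rewrite PoszD; apply: evaluates_add evaluates_input (evaluates_lit _).
move=> eva evb evc; rewrite /tab_addr !(PoszD, PoszM).
do ?[apply: evaluates_add => // | apply: evaluates_mul => //].
Qed.

Lemma evaluates_tab ea eb ec (a b c : nat) : evaluates N s ea a ->
  evaluates N s eb b -> evaluates N s ec c ->
  0 < a < radix N -> b < radix N -> c < radix N ->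
  evaluates N s (TabE ea eb ec) (tab s a b c).
Proof.
move=> eva evb evc a_N b_N c_N.
apply: evaluates_cell (evaluates_tab_addr eva evb evc) _ _.
  by case/andP: a_N => _ a_N; exact: in_range_tab.
by move=> m [_ _ mt _]; exact: mt.
Qed.

Lemma evaluates_out e (n : nat) : evaluates N s e n -> 0 < n <= N ->
  evaluates N s (Cell e) (out s n).
Proof.
move=> ev n_N; apply: evaluates_cell ev _ _.
  by case/andP: n_N => _ n_N; exact: in_range_out.
by move=> m [_ _ _ mo]; exact: mo.
Qed.

End Evaluation.

(** Total correctness: a halting run within the time bound is asserted, with the address bound built
    in. *)
Definition hoare N (P : heap -> Prop) (c : cmd) (Q : heap -> Prop) (t : nat) :=
  forall m s, represents N m s -> P s ->
  exists m' s' t' A, [/\ exec c m m' t' A, t' <= t, all (in_range N) A,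
    represents N m' s' & Q s'].

Section HoareRules.
Context (N : nat).

Lemma hoare_conseq (P P' Q Q' : heap -> Prop) c t t' :
  (forall s, P s -> P' s) -> (forall s, Q' s -> Q s) -> t' <= t ->
  hoare N P' c Q' t' -> hoare N P c Q t.
Proof.
move=> PP' Q'Q t't H m s rep /PP' Ps.
have [m' [s' [t1 [A [ex tt1 cells rep' /Q'Q Qs]]]]] := H m s rep Ps.
by exists m', s', t1, A; split=> //; apply: leq_trans t't.
Qed.

Lemma hoare_time P Q c t t' : t' <= t -> hoare N P c Q t' -> hoare N P c Q t.
Proof. by move=> t't; apply: hoare_conseq. Qed.

Lemma hoare_seq P Q R c1 c2 t1 t2 :
  hoare N P c1 Q t1 -> hoare N Q c2 R t2 -> hoare N P (Seq c1 c2) R (t1 + t2).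
Proof.
move=> H1 H2 m s rep Ps.
have [m1 [s1 [u1 [A1 [ex1 le1 cells1 rep1 Qs]]]]] := H1 m s rep Ps.
have [m2 [s2 [u2 [A2 [ex2 le2 cells2 rep2 Rs]]]]] := H2 m1 s1 rep1 Qs.
exists m2, s2, (u1 + u2), (A1 ++ A2); split=> //.
- exact: ExecSeq ex1 ex2.
- exact: leq_add.
- by rewrite all_cat cells1.
Qed.

Lemma hoare_set_var (P Q : heap -> Prop) i e : i < 8 ->
  (forall s, P s -> exists2 z, evaluates N s e z & Q (set_var s i z)) ->
  hoare N P (Store (Lit (Negz i)) e) Q (expr_time e).+2.
Proof.
move=> i8 H m s rep Ps; have [z ev Qs] := H s Ps; have [E cells] := ev m rep.
exists (update m (Negz i) z), (set_var s i z); do 2!eexists; split.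
- by rewrite -E; apply: ExecStore.
- by [].
- by rewrite /= in_range_var.
- exact: represents_set_var.
- by [].
Qed.

Lemma hoare_set_tab (P Q : heap -> Prop) (a b c : nat) (z : heap -> int) ea eb ec e :
  0 < a < radix N -> b < radix N -> c < radix N ->
  (forall s, P s -> [/\ evaluates N s ea a, evaluates N s eb b,
     evaluates N s ec c, evaluates N s e (z s) & Q (set_tab s a b c (z s))]) ->
  hoare N P (Store (TabAddrE ea eb ec) e) Q
    (expr_time (TabAddrE ea eb ec) + expr_time e).+1.
Proof.
move=> a_N b_N c_N H m s rep Ps; have [eva evb evc ev Qs] := H s Ps.
have [E cells] := ev m rep.
have [Ea cellsa] := evaluates_tab_addr eva evb evc rep.
exists (update m (tab_addr N a b c) (z s)), (set_tab s a b c (z s)).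
do 2!eexists; split.
- by rewrite -E -Ea; apply: ExecStore.
- by [].
- rewrite Ea [all _ _]/(_ && all _ _) all_cat cells cellsa in_range_tab //.
  by case/andP: a_N.
- exact: represents_set_tab.
- by [].
Qed.

Lemma hoare_set_out (P Q : heap -> Prop) (n : nat) (z : heap -> int) en e :
  0 < n <= N ->
  (forall s, P s -> [/\ evaluates N s en n, evaluates N s e (z s)
    & Q (set_out s n (z s))]) ->
  hoare N P (Store en e) Q (expr_time en + expr_time e).+1.
Proof.
move=> n_N H m s rep Ps; have [evn ev Qs] := H s Ps.
have [E cells] := ev m rep; have [En cellsn] := evn m rep.
exists (update m n (z s)), (set_out s n (z s)); do 2!eexists; split.
- by rewrite -E -En; apply: ExecStore.
- by [].
- by rewrite En /= all_cat cells cellsn in_range_out //; case/andP: n_N.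
- exact: represents_set_out.
- by [].
Qed.

(** The compared values are common to all states satisfying [P], so each branch is proved under the
    outcome that selects it. *)
Lemma hoare_if_lt P Q (x y : nat) e1 e2 c1 c2 t :
  (forall s, P s -> evaluates N s e1 x /\ evaluates N s e2 y) ->
  (x < y -> hoare N P c1 Q t) -> (y <= x -> hoare N P c2 Q t) ->
  hoare N P (If (TLt e1 e2) c1 c2) Q (test_time (TLt e1 e2) + t).
Proof.
move=> H H1 H2 m s rep Ps; have [ev1 ev2] := H s Ps.
have [E1 cells1] := ev1 m rep; have [E2 cells2] := ev2 m rep.
have E : eval_test m (TLt e1 e2) = (x < y) by rewrite /= E1 E2.
have cellsT : all (in_range N) (test_cells m (TLt e1 e2)).
  by rewrite /= all_cat cells1.
have [xy|yx] := ltnP x y.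
  have [m' [s' [u [A [ex le cells rep' Qs]]]]] := H1 xy m s rep Ps.
  exists m', s'; do 2!eexists; split.
  - by apply: ExecIfTrue ex; rewrite E.
  - by rewrite leq_add2l.
  - by rewrite all_cat cellsT.
  - by [].
  - by [].
have [m' [s' [u [A [ex le cells rep' Qs]]]]] := H2 yx m s rep Ps.
exists m', s'; do 2!eexists; split.
- by apply: ExecIfFalse ex; rewrite E -leqNgt.
- by rewrite leq_add2l.
- by rewrite all_cat cellsT.
- by [].
- by [].
Qed.

Lemma hoare_if_eq P Q (x y : nat) e1 e2 c1 c2 t :
  (forall s, P s -> evaluates N s e1 x /\ evaluates N s e2 y) ->
  (x = y -> hoare N P c1 Q t) -> (x != y -> hoare N P c2 Q t) ->
  hoare N P (If (TEq e1 e2) c1 c2) Q (test_time (TEq e1 e2) + t).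
Proof.
move=> H H1 H2 m s rep Ps; have [ev1 ev2] := H s Ps.
have [E1 cells1] := ev1 m rep; have [E2 cells2] := ev2 m rep.
have E : eval_test m (TEq e1 e2) = (x == y) by rewrite /= E1 E2.
have cellsT : all (in_range N) (test_cells m (TEq e1 e2)).
  by rewrite /= all_cat cells1.
have [xy|yx] := eqVneq x y.
  have [m' [s' [u [A [ex le cells rep' Qs]]]]] := H1 xy m s rep Ps.
  exists m', s'; do 2!eexists; split.
  - by apply: ExecIfTrue ex; rewrite E xy.
  - by rewrite leq_add2l.
  - by rewrite all_cat cellsT.
  - by [].
  - by [].
have [m' [s' [u [A [ex le cells rep' Qs]]]]] := H2 yx m s rep Ps.
exists m', s'; do 2!eexists; split.
- by apply: ExecIfFalse ex; rewrite E.
- by rewrite leq_add2l.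
- by rewrite all_cat cellsT.
- by [].
- by [].
Qed.

(** The invariant is indexed by the number of remaining iterations, which also gives termination. *)
Lemma hoare_while (J : nat -> heap -> Prop) (x y : nat -> nat) k e1 e2 body t :
  (forall d, d <= k -> (x d < y d) = (0 < d)) ->
  (forall d s, d <= k -> J d s -> evaluates N s e1 (x d) /\ evaluates N s e2 (y d)) ->
  (forall d, d < k -> hoare N (J d.+1) body (J d) t) ->
  hoare N (J k) (While (TLt e1 e2) body) (J 0)
    (test_time (TLt e1 e2) + k * (t + test_time (TLt e1 e2))).
Proof.
move=> xyE ev Hbody.
have test_run d s m : d <= k -> represents N m s -> J d s ->
    eval_test m (TLt e1 e2) = (0 < d)
    /\ all (in_range N) (test_cells m (TLt e1 e2)).
  move=> d_k rep Js; have [ev1 ev2] := ev d s d_k Js.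
  have [E1 cells1] := ev1 m rep; have [E2 cells2] := ev2 m rep.
  by rewrite /= E1 E2 all_cat cells1 -xyE.
(* Induction on the remaining iterations, with [k] kept fixed as their upper bound. *)
move: {1 3 4}k (leqnn k); elim=> [|d IH] d_k m s rep Js.
  have [E cells] := test_run _ _ _ d_k rep Js.
  exists m, s; do 2!eexists; split.
  - by apply: ExecWhileFalse; rewrite E.
  - by rewrite mul0n addn0.
  - by [].
  - by [].
  - by [].
have [E cells] := test_run _ _ _ d_k rep Js.
have [m1 [s1 [t1 [A1 [ex1 le1 cells1 rep1 Js1]]]]] := Hbody d d_k m s rep Js.
have [m2 [s2 [t2 [A2 [ex2 le2 cells2 rep2 Js2]]]]] := IH (ltnW d_k) m1 s1 rep1 Js1.
exists m2, s2; do 2!eexists; split.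
- by apply: ExecWhileTrue ex1 ex2; rewrite E.
- by move: le1 le2; rewrite mulSn; lia.
- by rewrite all_cat cells all_cat cells1.
- by [].
- by [].
Qed.

(** The decrement precedes the body, which thus sees [k - 1] down to [0], the order suited to suffix
    sums. *)
Definition countdown (x : nat) (e : expr) (body : cmd) : cmd :=
  Seq (Store (Lit (Negz x)) e)
    (While (TLt (Lit 0) (VarE x))
      (Seq (Store (Lit (Negz x)) (Sub (VarE x) (Lit 1))) body)).

(** [I i] is the invariant once the indices from [i] on are done. A test costs 4 and a decrement 6,
    hence 10 per round. *)
Lemma hoare_countdown (P : heap -> Prop) (I : nat -> heap -> Prop)
    (x k : nat) e body t : x < 8 ->
  (forall s, P s -> evaluates N s e k /\ I k s) ->
  (forall i s v, I i s -> I i (set_var s x v)) ->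
  (forall i, i < k -> hoare N (fun s => I i.+1 s /\ var s x = i) body
                            (fun s => I i s /\ var s x = i) t) ->
  hoare N P (countdown x e body) (I 0) (expr_time e + 6 + k * (t + 10)).
Proof.
move=> x8 Pinit Ivar Hbody; pose J i s := I i s /\ var s x = i.
have H1 : hoare N P (Store (Lit (Negz x)) e) (J k) (expr_time e).+2.
  apply: hoare_set_var => // s /Pinit[ev Ik]; exists (Posz k) => //.
  by split; [apply: Ivar | rewrite /= eqxx].
apply: (@hoare_conseq _ _ _ (J 0)) (hoare_seq H1 (hoare_while (J := J) (k := k)
  (x := fun=> 0) (y := id) (t := 6 + t) _ _ _)) => //; try by [].
- by move=> s [].
- by rewrite /=; lia.
- move=> d s _ [_ dE]; split; first exact: evaluates_lit.
  by rewrite -dE; apply: evaluates_var.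
- move=> d d_k; apply: hoare_seq (Hbody d d_k).
  apply: hoare_set_var => // s [Is dE]; exists (Posz d).
    have -> : Posz d = (var s x - 1)%R by rewrite dE; lia.
    exact: evaluates_sub (evaluates_var x8) (evaluates_lit _).
  by split; [apply: Ivar | rewrite /= eqxx].
Qed.

End HoareRules.

(** * The program *)

(** Each nesting level raises the exponent by one; the setup, at most 16, and the 10 per round are
    absorbed by 30. *)
Lemma hoare_countdown_poly N (P Q : heap -> Prop) (I : nat -> heap -> Prop)
    (x k : nat) e body c j : x < 8 -> expr_time e <= 10 -> k <= radix N ->
  (forall s, P s -> evaluates N s e k /\ I k s) ->
  (forall s, I 0 s -> Q s) ->
  (forall i s v, I i s -> I i (set_var s x v)) ->
  (forall i, i < k -> hoare N (fun s => I i.+1 s /\ var s x = i) body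
                        (fun s => I i s /\ var s x = i) (c * radix N ^ j)) ->
  hoare N P (countdown x e body) Q ((c + 30) * radix N ^ j.+1).
Proof.
move=> x8 e10 k_N Pinit I0 Ivar Hbody.
apply: hoare_conseq (hoare_countdown x8 Pinit Ivar Hbody) => //.
have D0 : 0 < radix N by rewrite /radix addn4.
have X0 : 0 < radix N ^ j by rewrite expn_gt0 D0.
rewrite expnS; move: (radix N ^ j) (radix N) X0 D0 k_N => X D; nia.
Qed.

(** The last update, from [k = N - 1], has sentinel [k + 2 = N + 1], so indices run over
    [0..N + 1]. *)
Definition rows (N : nat) := N + 2.
Definition RowsE : expr := Add (Cell (Lit 0)) (Lit 2).

Lemma evaluates_rows N s : evaluates N s RowsE (rows N).
Proof.
rewrite /rows PoszD; apply: evaluates_add; first exact: evaluates_input.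
exact: evaluates_lit.
Qed.

(* Variable 0 holds the current length [n], entry [(1, M + 1, r)] of the table holds
   E(M, r) and entry [(q + 2, M + 1, h)] holds C(q, M, h). *)
Definition accept_leaf (ec : expr) : cmd :=
  Store (TabAddrE (Lit 1) (ShiftE 1 1) (ShiftE 2 0))
    (Add (TabE (Lit 1) (ShiftE 1 1) (ShiftE 2 0))
      (Sub (TabE (ShiftE 3 2) (ShiftE 1 1) (Lit 0))
           (TabE (ShiftE 3 2) (ShiftE 1 1) ec))).

(** Variables 1, 2, 3 hold [M], [r], [q]; the conditional selects [minn q r]. *)
Definition fill_accept : cmd :=
  countdown 1 RowsE (countdown 2 RowsE (Seq
    (Store (TabAddrE (Lit 1) (ShiftE 1 1) (ShiftE 2 0)) (Lit 0))
    (countdown 3 RowsE (If (TLt (VarE 3) (VarE 2))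
      (accept_leaf (ShiftE 3 0)) (accept_leaf (ShiftE 2 0)))))).

Definition write_output : cmd :=
  countdown 1 RowsE (Store (VarE 0)
    (Add (Cell (VarE 0)) (TabE (Lit 1) (ShiftE 1 1) (ShiftE 0 0)))).

Definition suffix_leaf (e : expr) : cmd :=
  Store (TabAddrE (ShiftE 1 2) (ShiftE 2 1) (ShiftE 3 0))
    (Add (TabE (ShiftE 1 2) (ShiftE 2 1) (ShiftE 3 1)) e).

(* With [v1 = q] and [c = 0] or [1], the row read is that of [u = q + c - 1]. *)
Definition suffix_branch (c : nat) : cmd :=
  If (TEq (VarE 3) (VarE 2))
    (suffix_leaf (Add (TabE (ShiftE 1 c.+1) (ShiftE 2 0) (ShiftE 3 0))
                      (TabE (Lit 1) (ShiftE 1 c) (ShiftE 3 0))))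
    (suffix_leaf (TabE (ShiftE 1 c.+1) (ShiftE 2 0) (ShiftE 3 0))).

(* Counting down makes the update of the table in place sound: the entries read
   in the rows [q - 1, q] and [b] belong to the previous stage. *)
Definition update_suffix : cmd :=
  countdown 1 RowsE (countdown 2 RowsE (countdown 3 (ShiftE 0 1)
    (If (TEq (VarE 1) (VarE 3)) (suffix_leaf (Lit 0))
      (If (TLt (VarE 3) (VarE 1)) (suffix_branch 0) (suffix_branch 1))))).

(** [states k] concerns [k + 1] letters: the counter is raised first, the answer for that length is
    read off, and only then does the table advance. *)
Definition stage : cmd :=
  Seq (Store (Lit (Negz 0)) (ShiftE 0 1))
    (Seq fill_accept (Seq write_output update_suffix)).

(** The initial entry encodes the one-letter state [(1, 0, 0)], at [q + 2 = 3], [M + 1 = 1],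
    [h = 0]. *)
Definition pop_stacked_program : cmd :=
  Seq (Store (TabAddrE (Lit 3) (Lit 1) (Lit 0)) (Lit 1))
    (While (TLt (VarE 0) (Cell (Lit 0))) stage).

Ltac bounds := unfold rows, radix in *; lia.

(** * Loop invariants and running time of each phase *)

Section Correctness.
Context (N : nat).
Local Notation K := (rows N).

(** [fresh] marks the entries already overwritten with their values for [k.+1], as the in-place
    update requires. *)
Definition suffix_table k (fresh : nat -> nat -> nat -> bool) (s : heap) :=
  forall q b h, q < K -> b <= K -> h < K ->
  tab s (q + 2) b h = suffix_count (if fresh q b h then k.+1 else k) q b h.

Definition accept_table k (s : heap) :=
  forall M r, M < K -> r < K -> tab s 1 (M + 1) r = accept_count k M r 0.

Definition out_table k (s : heap) :=
  forall n, 0 < n <= N -> out s n = if n <= k then num_pop_stacked n else 0.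

Definition stage_inv (k n : nat) (s : heap) :=
  [/\ var s 0 = n, suffix_table k (fun _ _ _ => false) s & out_table k s].

(* Entry [(M, r)] holds the partial sum over the states with second maximum at
   least [q]; the entries after it in lexicographic order are complete. *)
Definition accept_partial (k M r q : nat) (s : heap) :=
  [/\ stage_inv k k.+1 s, var s 1 = M, var s 2 = r,
      forall M' r', M' < K -> r' < K -> (M < M') || (M == M') && (r < r') ->
        tab s 1 (M' + 1) r' = accept_count k M' r' 0
    & tab s 1 (M + 1) r = accept_count k M r q].

Lemma hoare_accept_leaf k M r q ec x : k < N -> M < K -> r < K -> q < K ->
  x = minn q r ->
  (forall s, var s 2 = r -> var s 3 = q -> evaluates N s ec x) ->
  expr_time ec <= 4 ->
  hoare N (fun s => accept_partial k M r q.+1 s /\ var s 3 = q) (accept_leaf ec)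
    (fun s => accept_partial k M r q s /\ var s 3 = q) 200.
Proof.
move=> k_N M_K r_K q_K xE ecE ec4.
apply: hoare_time; last first.
  apply: (@hoare_set_tab _ _ _ 1 (M + 1) r (fun=> accept_count k M r q));
  try bounds.
move=> s [[[nE sT oT] ME rE aT aE] qE].
have ev1 : evaluates N s (ShiftE 1 1) (M + 1)%N by apply: evaluates_shift.
have ev2 : evaluates N s (ShiftE 2 0) r.
  by rewrite -[r]addn0; apply: evaluates_shift.
have ev3 : evaluates N s (ShiftE 3 2) (q + 2)%N by apply: evaluates_shift.
have evx := ecE s rE qE.
split=> //.
- have -> : Posz (accept_count k M r q) =
      (tab s 1 (M + 1) r + (tab s (q + 2) (M + 1) 0 - tab s (q + 2) (M + 1) x))%R.
    rewrite aE !sT ?addn1; try bounds.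
    by have := accept_count_rec k M r q; rewrite -xE; lia.
  apply: evaluates_add; last apply: evaluates_sub; apply: evaluates_tab => //;
    bounds.
- split=> //; split=> // [|M' r' M'_K r'_K lt_Mr|]; last by rewrite /= !eqxx.
    split=> // q' b' h' q'_K b'_K h'_K.
    by rewrite /= -sT // addn2.
  by rewrite /= eqn_add2r; case: andP => [[/eqP E1 /eqP E2]|_]; [lia|apply: aT].
- by rewrite /=; lia.
Qed.

Lemma hoare_fill_accept k : k < N ->
  hoare N (stage_inv k k.+1) fill_accept
    (fun s => stage_inv k k.+1 s /\ accept_table k s) (500 * radix N ^ 3).
Proof.
move=> k_N.
apply: hoare_time; last first.
  apply: (@hoare_countdown_poly _ _ _
    (fun i s => stage_inv k k.+1 s /\ forall M r, M < K -> r < K -> i <= M ->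
       tab s 1 (M + 1) r = accept_count k M r 0) 1 K RowsE _ 440 2
    _ _ _ _ _ _ _) => //.
  - by bounds.
  - by move=> s inv; split; [exact: evaluates_rows | split=> // M r; lia].
  - by move=> s [inv aT]; split=> // M r M_K r_K; apply: aT.
  move=> M M_K; apply: hoare_time; last first.
    apply: (@hoare_countdown_poly _ _ _
      (fun i s => [/\ stage_inv k k.+1 s, var s 1 = M &
         forall M' r, M' < K -> r < K -> (M < M') || (M == M') && (i <= r) ->
         tab s 1 (M' + 1) r = accept_count k M' r 0]) 2 K RowsE _ 400 1
      _ _ _ _ _ _ _) => //.
    - by bounds.
    - move=> s [[inv aT] ME]; split; first exact: evaluates_rows.
      by split=> // M' r M'_K r_K lt_M; apply: aT => //; lia.
    - move=> s [inv ME aT]; split=> //; split=> // M' r M'_K r_K le_M.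
      by apply: aT => //; lia.
    move=> r r_K; apply: (@hoare_time _ _ _ _ _ (60 + 330 * radix N ^ 1)); last first.
      apply: (@hoare_seq _ _ (accept_partial k M r K)).
        apply: hoare_time; last first.
          apply: (@hoare_set_tab _ _ _ 1 (M + 1) r (fun=> 0)); try bounds.
          move=> s [[[nE sT oT] ME aT] rE]; split=> //.
          + exact: evaluates_shift.
          + by rewrite -[r]addn0; apply: evaluates_shift.
          split=> // [|M' r' M'_K r'_K lt_Mr|]; last first.
          (* The partial sum from [q = K] on is empty, since [k.+1 < K]. *)
          + by rewrite /= !eqxx accept_count_ge //; bounds.
          + by rewrite /= eqn_add2r; case: andP => [[/eqP E1 /eqP E2]|_];
              [lia | apply: aT => //; lia].
          split=> // q' b' h' q'_K b'_K h'_K.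
          by rewrite /= -sT // addn2.
        by [].
      apply: (@hoare_countdown_poly _ _ _ (accept_partial k M r) 3 K RowsE _ 300 0
        _ _ _ _ _ _ _) => //.
      - by bounds.
      - by move=> s H; split; first exact: evaluates_rows.
      (* At [q = 0] the partial sum is complete, so entry [(M, r)] joins the later ones. *)
      - move=> s [inv ME rE aT aE]; split=> //; split=> // M' r' M'_K r'_K lt_M.
        have [/andP[/eqP E1 /eqP E2]|E] := boolP ((M == M') && (r == r')).
          by rewrite -E1 -E2.
        by apply: aT => //; lia.
      move=> q q_K; rewrite expn0 muln1; apply: hoare_time; last first.
        apply: (@hoare_if_lt _ _ _ q r _ _ _ _ 200).
        + by move=> s [[inv ME rE aT aE] qE]; split; rewrite -?rE -?qE; apply: evaluates_var.
        + move=> qr; apply: (@hoare_accept_leaf k M r q _ q) => //; first lia.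
          by move=> s rE qE; rewrite -[q]addn0; apply: evaluates_shift.
        + move=> rq; apply: (@hoare_accept_leaf k M r q _ r) => //; first lia.
          by move=> s rE qE; rewrite -[r]addn0; apply: evaluates_shift.
      by [].
    by rewrite expn1 /radix; lia.
  by rewrite leq_mul2r; lia.
by rewrite leq_mul2r; lia.
Qed.

Lemma hoare_write_output k : k < N ->
  hoare N (fun s => stage_inv k k.+1 s /\ accept_table k s) write_output
    (fun s => [/\ var s 0 = k.+1, suffix_table k (fun _ _ _ => false) s,
       out_table k.+1 s & accept_table k s]) (130 * radix N ^ 1).
Proof.
move=> k_N; apply: (@hoare_countdown_poly _ _ _
  (fun i s => [/\ var s 0 = k.+1, suffix_table k (fun _ _ _ => false) s,
     (forall n, 0 < n <= N -> out s n = if n <= k then num_pop_stacked n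
        else if n == k.+1 then accept_from k i else 0) & accept_table k s])
  1 K RowsE _ 100 0 _ _ _ _ _ _ _) => //.
- by bounds.
(* No maximum reaches [K], so [accept_from k K = 0] matches the output cell, still zero. *)
- move=> s [[nE sT oT] aT]; split; first exact: evaluates_rows.
  split=> // n n_N; rewrite oT // accept_from_ge; last by bounds.
  by case: ifP => // _; case: eqP.
- move=> s [nE sT oT aT]; split=> // n n_N; rewrite oT //.
  have [n_k|k_n] := leqP n k; first by rewrite leqW.
  by rewrite accept_from0 [n <= _]leq_eqVlt ltnS leqNgt k_n orbF; case: eqP => [->|].
move=> M M_K; rewrite expn0 muln1; apply: hoare_time; last first.
  apply: (@hoare_set_out _ _ _ k.+1 (fun=> accept_from k M)); first by bounds.
  move=> s [[nE sT oT aT] ME]; have ev0 : evaluates N s (VarE 0) k.+1.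
    by rewrite -nE; apply: evaluates_var.
  split=> //.
    have -> : Posz (accept_from k M) = (out s k.+1 + tab s 1 (M + 1) k.+1)%R.
      by rewrite oT ?aT ?ltnn ?eqxx ?(accept_from_rec k M) //; bounds.
    apply: evaluates_add; first by apply: evaluates_out => //; bounds.
    apply: evaluates_tab => //; try bounds; first exact: evaluates_shift.
    by rewrite -[k.+1]addn0; apply: evaluates_shift.
  split=> //; split=> // n n_N.
  by rewrite /= oT //; case: (eqVneq n) => [->|//]; rewrite ltnn.
by [].
Qed.

Definition update_inv k fresh (s : heap) :=
  [/\ var s 0 = k.+1, suffix_table k fresh s, out_table k.+1 s & accept_table k s].

(** Entries from [(q, b, h)] on in lexicographic order, which the loops traverse downwards. *)
Definition fresh_entry (q b h q' b' h' : nat) :=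
  (q < q') || (q == q') && ((b < b') || (b == b') && (h <= h')).

Lemma hoare_suffix_leaf k q b h e (v : nat) : q < K -> b < K -> h <= k.+1 -> k < N ->
  suffix_count k.+1 q b.+1 h = suffix_count k.+1 q b.+1 h.+1 + v ->
  (forall s, [/\ update_inv k (fresh_entry q b.+1 h.+1) s,
     var s 1 = q, var s 2 = b & var s 3 = h] -> evaluates N s e v) ->
  expr_time e <= 100 ->
  hoare N (fun s => [/\ update_inv k (fresh_entry q b.+1 h.+1) s,
             var s 1 = q & var s 2 = b] /\ var s 3 = h) (suffix_leaf e)
    (fun s => [/\ update_inv k (fresh_entry q b.+1 h) s,
             var s 1 = q & var s 2 = b] /\ var s 3 = h) 200.
Proof.
move=> q_K b_K h_k k_N rec evE e_time; apply: hoare_time; last first.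
  apply: (@hoare_set_tab _ _ _ (q + 2) (b + 1) h
    (fun=> suffix_count k.+1 q b.+1 h)); try bounds.
  move=> s [[[nE sT oT aT] qE bE] hE].
  have ev1 : evaluates N s (ShiftE 1 2) (q + 2)%N by apply: evaluates_shift.
  have ev2 : evaluates N s (ShiftE 2 1) (b + 1)%N by apply: evaluates_shift.
  have ev3 : evaluates N s (ShiftE 3 1) (h + 1)%N by apply: evaluates_shift.
  split=> //.
  - by rewrite -[h]addn0; apply: evaluates_shift.
  - rewrite rec PoszD; apply: evaluates_add; last exact: evE.
    (* The entry at [h.+1] was overwritten just before and already belongs to the new stage. *)
    have -> : Posz (suffix_count k.+1 q b.+1 h.+1) = tab s (q + 2) (b + 1) (h + 1).
      by rewrite sT ?addn1 /fresh_entry ?eqxx ?leqnn ?orbT //=; bounds.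
    by apply: evaluates_tab => //; bounds.
  split=> //; split=> //; split=> // [q' b' h' q'_K b'_K h'_K|M r M_K r_K] /=; last first.
    by rewrite -aT // addn2.
  rewrite eqn_add2r; case: and3P => [[/eqP -> /eqP -> /eqP ->]|ne].
    by rewrite /fresh_entry addn1 !eqxx leqnn !orbT.
  rewrite sT // /fresh_entry; congr (Posz (suffix_count _ _ _ _)).
  have : ~~ [&& q' == q, b' == b + 1 & h' == h] by apply/and3P.
  by move=> {}ne; congr (if _ then _ else _); lia.
by rewrite /=; lia.
Qed.

Lemma hoare_suffix_branch k q b h u c : q < K -> b < K -> h <= k.+1 -> k < N ->
  c <= 1 -> q != h -> q + c = u + 1 -> u = unbump h q ->
  hoare N (fun s => [/\ update_inv k (fresh_entry q b.+1 h.+1) s,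
             var s 1 = q & var s 2 = b] /\ var s 3 = h) (suffix_branch c)
    (fun s => [/\ update_inv k (fresh_entry q b.+1 h) s,
             var s 1 = q & var s 2 = b] /\ var s 3 = h) 210.
Proof.
move=> q_K b_K h_k k_N c1 q_h qc_u uE.
have rec := @suffix_count_rec k q b h h_k; rewrite (negPf q_h) -uE in rec.
have prevE s : [/\ update_inv k (fresh_entry q b.+1 h.+1) s,
     var s 1 = q, var s 2 = b & var s 3 = h] ->
   evaluates N s (TabE (ShiftE 1 c.+1) (ShiftE 2 0) (ShiftE 3 0)) (suffix_count k u b h).
  case=> -[nE sT oT aT] qE bE hE.
  have -> : Posz (suffix_count k u b h) = tab s (u + 2) b h.
    (* As [u <= q] and [b < b.+1], this entry precedes the current one and still belongs to the old
       stage. *)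
    rewrite sT; try bounds.
    by rewrite ifF // /fresh_entry; apply/negbTE; bounds.
  apply: evaluates_tab; try bounds.
  - have -> : u + 2 = q + c.+1 by lia.
    exact: evaluates_shift.
  - by rewrite -[b]addn0; apply: evaluates_shift.
  - by rewrite -[h]addn0; apply: evaluates_shift.
apply: (@hoare_time _ _ _ _ _ (test_time (TEq (VarE 3) (VarE 2)) + 200)) => //.
apply: (@hoare_if_eq _ _ _ h b).
- by move=> s [[inv qE bE] hE]; split; rewrite -?bE -?hE; apply: evaluates_var.
- move=> hb; rewrite ifT in rec; last exact/eqP.
  apply: hoare_suffix_leaf rec _ _ => // s inv.
  rewrite PoszD; apply: evaluates_add; first exact: prevE.
  case: inv => -[nE sT oT aT] qE bE hE.
  rewrite -aT; try bounds.
  apply: evaluates_tab => //; try bounds.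
  - by rewrite -qc_u; apply: evaluates_shift.
  - by rewrite -[h]addn0; apply: evaluates_shift.
- move=> hb; rewrite (negPf hb) addn0 in rec.
  by apply: hoare_suffix_leaf rec _ _.
Qed.

(** Lets the marking change for free on entries where both stages agree, so the loops may skip
    them. *)
Lemma suffix_table_eq k f g s : suffix_table k f s ->
  (forall q b h, q < K -> b <= K -> h < K -> f q b h != g q b h ->
     suffix_count k.+1 q b h = suffix_count k q b h) ->
  suffix_table k g s.
Proof.
move=> sT fg q b h q_K b_K h_K; rewrite sT //; congr Posz.
have := fg q b h q_K b_K h_K.
by case: (f q b h); case: (g q b h) => // ->.
Qed.

Lemma hoare_update_suffix k : k < N ->
  hoare N (update_inv k (fun _ _ _ => false)) update_suffix
    (stage_inv k.+1 k.+1) (400 * radix N ^ 3).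
Proof.
move=> k_N; apply: hoare_time; last first.
  apply: (@hoare_countdown_poly _ _ _
    (fun i => update_inv k (fun q b h => i <= q)) 1 K RowsE _ 340 2
    _ _ _ _ _ _ _) => //.
  - by bounds.
  - move=> s [nE sT oT aT]; split; first exact: evaluates_rows.
    split=> //; apply: suffix_table_eq sT _ => q b h; lia.
  - by move=> s [nE sT oT aT]; split.
  move=> q q_K; apply: hoare_time; last first.
    apply: (@hoare_countdown_poly _ _ _
      (* Counter value [b] handles row [b + 1], hence [i.+1]; row 0 always vanishes. *)
      (fun i s => update_inv k (fun q' b h => fresh_entry q i.+1 0 q' b h) s
                  /\ var s 1 = q) 2 K RowsE _ 290 1
      _ _ _ _ _ _ _) => //.
    - by bounds.
    - move=> s [[nE sT oT aT] qE]; split; first exact: evaluates_rows.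
      split=> //; split=> //; apply: suffix_table_eq sT _ => q' b h ? ? ?.
      by rewrite /fresh_entry; lia.
    - move=> s [[nE sT oT aT] qE]; split=> //; split=> //.
      apply: suffix_table_eq sT _ => q' b h ? ? ?; rewrite /fresh_entry => ne.
      by have -> : b = 0; [lia | rewrite !suffix_count_row0].
    move=> b b_K; apply: hoare_time; last first.
      apply: (@hoare_countdown_poly _ _ _
        (fun i s => [/\ update_inv k (fresh_entry q b.+1 i) s, var s 1 = q
                      & var s 2 = b]) 3 k.+2 (ShiftE 0 1) _ 250 0
        _ _ _ _ _ _ _) => //.
      - by bounds.
      - move=> s [[[nE sT oT aT] qE] bE]; split.
          by rewrite -[k.+2]addn1; apply: evaluates_shift.
        (* The columns from [k.+2] on are zero at both stages and need no visit. *)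
        split=> //; split=> //; apply: suffix_table_eq sT _ => q' b' h ? ? ?.
        rewrite /fresh_entry => ne.
        by rewrite !suffix_count_ge //; lia.
      - move=> s [[nE sT oT aT] qE bE]; split=> //; split=> //; split=> //.
      move=> h h_k; rewrite expn0 muln1; apply: hoare_time; last first.
        apply: (@hoare_if_eq _ _ _ q h _ _ _ _ 230).
        + by move=> s [[inv qE bE] hE]; split; rewrite -?qE -?hE; apply: evaluates_var.
        + move=> qh; have := @suffix_count_rec k q b h h_k; rewrite ifT; last exact/eqP.
          move=> rec; apply: (@hoare_time _ _ _ _ _ 200) => //.
          exact: hoare_suffix_leaf rec _ _.
        move=> qh; apply: hoare_time; last first.
          apply: (@hoare_if_lt _ _ _ h q _ _ _ _ 210).
          * by move=> s [[inv qE bE] hE]; split; rewrite -?qE -?hE; apply: evaluates_var.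
          * move=> hq; apply: (@hoare_suffix_branch k q b h q.-1 0) => //; try lia.
            by rewrite /unbump; lia.
          * move=> qh'; apply: (@hoare_suffix_branch k q b h q 1) => //; try lia.
            by rewrite /unbump; lia.
        by [].
      by [].
    by rewrite leq_mul2r; lia.
  by rewrite leq_mul2r; lia.
by rewrite leq_mul2r; lia.
Qed.

Lemma hoare_stage k : k < N ->
  hoare N (stage_inv k k) stage (stage_inv k.+1 k.+1) (2000 * radix N ^ 3).
Proof.
move=> k_N; apply: hoare_time; last first.
  apply: (@hoare_seq _ _ (stage_inv k k.+1)); last first.
    apply: hoare_seq (hoare_fill_accept k_N) _.
    by apply: hoare_seq (hoare_write_output k_N) (hoare_update_suffix k_N).
  apply: hoare_set_var => // s [nE sT oT]; exists (Posz k.+1) => //.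
  by rewrite -[k.+1]addn1; apply: evaluates_shift.
have : 0 < radix N by rewrite /radix addn4.
by rewrite [expr_time _]/= !expnS expn0; nia.
Qed.

Lemma hoare_pop_stacked_program : 0 < N ->
  hoare N (fun s => s = empty_heap) pop_stacked_program (out_table N)
    (3000 * radix N ^ 4).
Proof.
move=> N0; apply: hoare_time; last first.
  apply: (@hoare_seq _ _ (stage_inv 0 0)).
    apply: (@hoare_set_tab _ _ _ 3 1 0 (fun=> 1%R)); try bounds.
    move=> s ->; split=> //; split=> // [q b h _ _ _|n n_N] /=; last first.
      by case: n n_N.
    rewrite /suffix_count /=; case: h => [|h]; rewrite ?andbF //= !andbT.
    by rewrite -[3]/(1 + 2) eqn_add2r [1 == q]eq_sym [1 == b]eq_sym; case: andP.
  (* With [i] iterations remaining, [N - i] stages are complete. *)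
  apply: hoare_conseq (hoare_while (J := fun i => stage_inv (N - i) (N - i))
    (k := N) (x := fun i => N - i) (y := fun=> N) (t := 2000 * radix N ^ 3)
    _ _ _) => //.
  - by rewrite subnn.
  - by rewrite subn0 => s [].
  - by move=> i i_N; lia.
  - move=> i s i_N [nE _ _]; split; last exact: evaluates_input.
    by rewrite -nE; apply: evaluates_var.
  - move=> i i_N; have -> : N - i = (N - i.+1).+1 by lia.
    by apply: hoare_stage; lia.
have D4 : 4 < radix N by rewrite /radix; lia.
have ND : N <= radix N by rewrite leq_addr.
have X0 : 0 < radix N ^ 3 by rewrite expn_gt0; lia.
rewrite !(expnS _ 3) [test_time _]/= [expr_time _]/= [expr_time (Lit 1)]/=.
move: (radix N ^ 3) (radix N) X0 D4 ND => X D *; nia.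
Qed.

End Correctness.

Theorem mainTheorem1 :
  exists (prog : cmd) (Ct Cs : nat), forall N : nat, 0 < N ->
    exists (m : memory) (t : nat) (A : seq int),
      [/\ exec prog (input N) m t A,
          forall n : nat, 1 <= n <= N -> m (Posz n) = Posz (num_pop_stacked n),
          t <= Ct * N ^ 4
        & cells_used A <= Cs * N ^ 3].
Proof.
(* The 5 comes from [N + 4 <= 5 * N], and the 3 from bounding [2 * B + 1] by [3 * B] with
   [B = radix N ^ 3]. *)
exists pop_stacked_program, (3000 * 5 ^ 4), (3 * 5 ^ 3) => N N0.
have [m [s [t [A [ex t_le cells rep outs]]]]] :=
  hoare_pop_stacked_program N0 (represents_input N) erefl.
have le_radix : radix N <= 5 * N by rewrite /radix; lia.
exists m, t, A; split=> //.
- move=> n n_N; have [_ _ _ -> //] := rep.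
  by rewrite outs //; case/andP: n_N => _ ->.
- by rewrite -mulnA -expnMn (leq_trans t_le) // leq_mul2l leq_exp2r.
- rewrite -mulnA -expnMn (leq_trans (cells_used_in_range cells)) //.
  have X0 : 0 < radix N ^ 3 by rewrite expn_gt0 /radix; lia.
  have : radix N ^ 3 <= (5 * N) ^ 3 by rewrite leq_exp2r.
  by move: (radix N ^ 3) ((5 * N) ^ 3) X0 => X Y; lia.
Qed.
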